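(* Let $\gamma$ be a translation invariant specification, and let $\mu\in\mathcal M_{1,\mathrm{inv}}^+$ and $\nu\in\mathcal G_{\mathrm{inv}}(\gamma)$ be such that the following hold: (C1) $\mu(\Omega_\gamma^{<0})=1$; (C2) $\mu\in\mathcal G_{\mathrm{inv}}(\gamma)$ is such that $\lim_{\Lambda\uparrow\mathbb Z^d}\frac1{|\Lambda|}\log\frac{\mu(+_\Lambda)}{\nu(+_\Lambda)}=0$; and such that $e_\nu^+$ exists. Then: 1. $h(\mu|\nu)$ exists. 2. $\mu\in\mathcal G_{\mathrm{inv}}(\gamma)$ implies $h(\mu|\nu)=0$.
   Context: $E$ is a finite set, $\Omega=E^{\mathbb Z^d}$ with product topology and Borel $\sigma$-field $\mathcal F$. $\mathcal S$ is the set of finite subsets of $\mathbb Z^d$; $\mathcal F_\Lambda$ is the $\sigma$-field generated by the coordinates in $\Lambda$; $\sigma_\Lambda$ is the restriction of $\sigma$ to $\Lambda$, and $\mu(\sigma_\Lambda)$ is the $\mu$-probability of the corresponding cylinder. A function is local if it is $\mathcal F_\Delta$-measurable for some $\Delta\in\mathcal S$. Translations: $(\tau_x\omega)(y)=\omega(x+y)$. $\mathcal M_{1,\mathrm{inv}}^+$ is the set of translation invariant probability measures on $\Omega$. A specification is a family $\gamma=\{\gamma_\Lambda\}_{\Lambda\in\mathcal S}$ of probability kernels from $\Omega_{\Lambda^c}=E^{\Lambda^c}$ to $\mathcal F$ that is proper ($\gamma_\Lambda(B|\omega)=\mathbf 1_B(\omega)$ for $B\in\mathcal F_{\Lambda^c}$,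 all $\omega$) and consistent ($\gamma_{\Lambda'}\gamma_\Lambda=\gamma_{\Lambda'}$ for $\Lambda\subset\Lambda'$, everywhere). $\gamma_\Lambda(\sigma|\omega)$ denotes the $\gamma_\Lambda(\cdot|\omega)$-probability of $\{\omega':\omega'_\Lambda=\sigma_\Lambda\}$, and $\gamma_\Lambda f(\omega)=\int f\,d\gamma_\Lambda(\cdot|\omega)$. All specifications are assumed non-null: for each $\Lambda\in\mathcal S$ there are $0<a_\Lambda<b_\Lambda<1$ with $a_\Lambda<\inf_{\sigma,\eta}\gamma_\Lambda(\sigma|\eta)\le\sup_{\sigma,\eta}\gamma_\Lambda(\sigma|\eta)<b_\Lambda$. $\gamma$ is translation invariant if $\gamma_{\Lambda+x}(A|\omega)=\gamma_\Lambda(\tau_xA|\tau_x\omega)$. $\mathcal G(\gamma)$ is the set of probability measures $\mu$ with $\mu[A|\mathcal F_{\Lambda^c}]=\gamma_\Lambda(A|\cdot)$ $\mu$-a.s. for all $A\in\mathcal F,\Lambda\in\mathcal S$; $\mathcal G_{\mathrm{inv}}(\gamma)$ is the set of its translation invariant elements. $\Omega_\gamma$ is the set of $\omega$ such that $\gamma_\Lambda f$ is continuous at $\omega$ for all $\Lambda\in\mathcal S$ and all local $f$. A value $+1\in E$ is fixed; $+$ is the configuration identically $+1$ and $+_\Lambda$ its restriction to $\Lambda$. For $\sigma\in\Omega$, $\sigma^+(x)=\sigma(x)$ if $x\le0$ and $\sigma^+(x)=+1$ if $x>0$, with $\le$ the lexicographic order on $\mathbb Z^d$. $\Omega_\gamma^{<0}=\{\sigma\in\Omega:\sigma^+\in\Omega_\gamma\}$.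 $\Lambda_n=[-n,n]^d\cap\mathbb Z^d$ (this may be replaced by a Van Hove sequence), and all limits $\Lambda\uparrow\mathbb Z^d$ are taken along this sequence. $e_\nu^+=-\lim_{\Lambda\uparrow\mathbb Z^d}|\Lambda|^{-1}\log\nu(+_\Lambda)$ whenever the limit exists. $h(\mu|\nu)=\lim_n|\Lambda_n|^{-1}h_{\Lambda_n}(\mu|\nu)$ when the limit exists, where $h_\Lambda(\mu|\nu)=\sum_{\sigma_\Lambda}\mu(\sigma_\Lambda)\log\frac{\mu(\sigma_\Lambda)}{\nu(\sigma_\Lambda)}$ if $\mu_\Lambda\ll\nu_\Lambda$ (marginals on $E^\Lambda$) and $+\infty$ otherwise. *)

(* Defs.v *)
From HB Require Import structures.
From mathcomp Require Import all_boot all_order all_algebra.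
From mathcomp Require Import finmap.
From mathcomp Require Import all_classical all_reals all_analysis.
From mathcomp Require Import measurable_realfun.

Set Implicit Arguments.
Unset Strict Implicit.
Unset Printing Implicit Defensive.

Import Order.TTheory GRing.Theory Num.Theory.
Import numFieldNormedType.Exports.

Local Open Scope classical_set_scope.
Local Open Scope ring_scope.

(* The configuration space E^(Z^d), Z^d being 'rV[int]_d. The distinguished
   spin p (the value "+1") is a parameter of the type only because
   MathComp-Analysis wants measurable spaces to be pointed: the point is the
   configuration identically equal to p. *)
Definition config (d : nat) (E : finType) (p : E) : Type := 'rV[int]_d -> E.

Definition plus_config (d : nat) (E : finType) (p : E) : config d p :=
  fun=> p.

Section ConfigStructures.
Context (d : nat) (E : finType) (p : E).

HB.instance Definition _ := Choice.copy (config d p)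
  (prod_topology (fun _ : 'rV[int]_d => discrete_topology E)).
HB.instance Definition _ := Topological.copy (config d p)
  (prod_topology (fun _ : 'rV[int]_d => discrete_topology E)).
HB.instance Definition _ := isPointed.Build (config d p) (@plus_config d E p).
HB.instance Definition _ := Measurable.copy (config d p)
  (g_sigma_algebraType (@open (config d p))).

End ConfigStructures.

Section Configurations.
Context (d : nat) (E : finType) (p : E).
Local Notation Zd := 'rV[int]_d.
Local Notation Omega := (config d p).

Definition restr (L : {fset Zd}) (s : Omega) : {ffun L -> E} :=
  [ffun x : L => s (val x)].

Definition cylinder (L : {fset Zd}) (s : {ffun L -> E}) : set Omega :=
  [set w | restr L w = s].

(* F_L, for L an arbitrary set of sites, is <<s coord_events L >>. *)
Definition coord_events (L : set Zd) : set (set Omega) :=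
  [set A | exists2 x, L x & exists B : set E, A = [set w | B (w x)]].

Definition coord_space (L : set Zd) := g_sigma_algebraType (coord_events L).

Definition shift (x : Zd) (s : Omega) : Omega := fun y => s (x + y).

Definition lex_le (x y : Zd) : bool :=
  (([tuple x 0 i | i < d] : d.-tuplelexi int) <=
   ([tuple y 0 i | i < d] : d.-tuplelexi int))%O.

Definition plus_future (s : Omega) : Omega :=
  fun x => if lex_le x 0 then s x else p.

End Configurations.

Definition translate (d : nat) (L : {fset 'rV[int]_d}) (x : 'rV[int]_d) :
  {fset 'rV[int]_d} := [fset (y + x)%R | y in L]%fset.

(* [-n, n]^d: a coordinate in {-n, ..., n} is written k - n, with k <= 2n. *)
Definition box (d n : nat) : {fset 'rV[int]_d} :=
  let site (k : {ffun 'I_d -> 'I_(n.*2.+1)}) : 'rV[int]_d :=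
    \row_i ((k i)%:Z - n%:Z) in
  [fset site k | k in {: {ffun 'I_d -> 'I_(n.*2.+1)}}]%fset.

Section Specifications.
Context (R : realType) (d : nat) (E : finType) (p : E).
Local Notation Zd := 'rV[int]_d.
Local Notation Omega := (config d p).

(* A kernel from E^(L^c) is encoded as a kernel from Omega equipped with
   F_{L^c}. The empty set has to be excluded from non-nullness, since
   [spec_kernel fset0] gives probability 1 to the only (empty) pattern. *)
Record specification := Specification {
  spec_kernel :> forall L : {fset Zd}, R.-pker (coord_space p (~` [set` L])) ~> Omega ;
  spec_proper : forall (L : {fset Zd}) (w : Omega) (B : set Omega),
    <<s coord_events (~` [set` L]) >> B -> spec_kernel L w B = (\1_B w)%:E ;
  spec_consistent : forall (L L' : {fset Zd}), (L `<=` L')%fset ->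
    forall (w : Omega) (A : set Omega), measurable A ->
    (\int[spec_kernel L' w]_v spec_kernel L v A)%E = spec_kernel L' w A ;
  spec_nonnull : forall L : {fset Zd}, L != fset0 ->
    exists a b : R, [/\ 0 < a, a < b, b < 1,
      (a%:E < ereal_inf [set spec_kernel L v (cylinder (restr L s)) |
                          s in [set: Omega] & v in [set: Omega]])%E &
      (ereal_sup [set spec_kernel L v (cylinder (restr L s)) |
                          s in [set: Omega] & v in [set: Omega]] < b%:E)%E]
}.

Definition spec_translation_invariant (g : specification) : Prop :=
  forall (L : {fset Zd}) (x : Zd) (w : Omega) (A : set Omega), measurable A ->
    g (translate L x) w A = g L (shift x w) (@shift d E p x @` A).

Definition translation_invariant (mu : probability Omega R) : Prop :=
  forall (x : Zd) (A : set Omega), measurable A ->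
    mu (@shift d E p x @^-1` A) = mu A.

(* f is a version of the conditional probability mu[A | <<s G >>]. *)
Definition cond_prob_version (mu : probability Omega R)
    (G : set (set Omega)) (A : set Omega) (f : Omega -> \bar R) : Prop :=
  @measurable_fun _ _ (g_sigma_algebraType G) (\bar R) setT f /\
  forall B : set Omega, <<s G >> B ->
    (\int[mu]_(w in B) f w)%E = mu (A `&` B).

Definition gibbs (g : specification) (mu : probability Omega R) : Prop :=
  forall (L : {fset Zd}) (A : set Omega), measurable A ->
    cond_prob_version mu (coord_events (~` [set` L])) A (fun w => g L w A).

Definition gibbs_inv (g : specification) (mu : probability Omega R) : Prop :=
  gibbs g mu /\ translation_invariant mu.

Definition local_fun (f : Omega -> R) : Prop :=
  exists D : {fset Zd},
    @measurable_fun _ _ (coord_space p [set` D]) R setT f.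

(* The set written Omega_gamma; the next one is Omega_gamma^{<0}. *)
Definition continuity_set (g : specification) : set Omega :=
  [set w | forall (L : {fset Zd}) (f : Omega -> R), local_fun f ->
    {for w, continuous (fun v : Omega => \int[g L v]_u f u)}].

Definition past_continuity_set (g : specification) : set Omega :=
  [set s | continuity_set g (plus_future s)].

Definition pattern_prob (mu : probability Omega R) (L : {fset Zd})
  (s : {ffun L -> E}) : R := fine (mu (@cylinder d E p L s)).

Definition plus_prob (mu : probability Omega R) (L : {fset Zd}) : R :=
  pattern_prob mu (restr L (@plus_config d E p)).

(* The limit of plus_rate nu is the quantity e_nu^+. In MathComp-Analysis
   ln x = 0 for x <= 0; this is harmless since, by non-nullness, Gibbs measures
   give positive probability to all cylinders. *)
Definition plus_rate (nu : probability Omega R) (n : nat) : R :=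
  - (#|` box d n|%:R^-1 * ln (plus_prob nu (box d n))).

Definition plus_rate_exists (nu : probability Omega R) : Prop :=
  cvgn (plus_rate nu).

(* Absolute continuity of the marginal of mu on E^L w.r.t. that of nu. *)
Definition marginal_dominates (nu mu : probability Omega R) (L : {fset Zd}) :
  Prop :=
  forall S : set {ffun L -> E},
    nu (@restr d E p L @^-1` S) = 0%E -> mu (@restr d E p L @^-1` S) = 0%E.

(* The value ln 0 = 0 implements the conventions 0 log 0 = 0 and
   0 log (0/0) = 0. *)
Definition rel_entropy (L : {fset Zd}) (mu nu : probability Omega R) : \bar R :=
  if `[< marginal_dominates nu mu L >] then
    (\sum_(s : {ffun L -> E})
       pattern_prob mu s * ln (pattern_prob mu s / pattern_prob nu s))%:E
  else +oo%E.

(* h is the limit denoted h(mu | nu). *)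
Definition is_rel_entropy_density (mu nu : probability Omega R) (h : \bar R) :
  Prop :=
  ((#|` box d n|%:R^-1)%:E * rel_entropy (box d n) mu nu)%E @[n --> \oo] --> h.

End Specifications.

(* Main.v *)
Require Import Defs.
From HB Require Import structures.
From mathcomp Require Import all_boot all_order all_algebra.
From mathcomp Require Import finmap.
From mathcomp Require Import all_classical all_reals all_analysis.
From mathcomp Require Import measurable_realfun.
From mathcomp Require Import zify lra ring.

Set Implicit Arguments.
Unset Strict Implicit.
Unset Printing Implicit Defensive.

Import Order.TTheory GRing.Theory Num.Theory.
Import numFieldNormedType.Exports.
Local Open Scope classical_set_scope.
Local Open Scope ring_scope.

(** Write a window probability of nu as a product along the lexicographic order:
    start from the pattern + on the window L and turn its sites, from the least
    to the greatest, into those of a configuration w. The step at x multiplies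
    the probability by nu(w_(<= x) +_(> x)) / nu(w_(< x) +_(>= x)). Seen from x,
    and after integration over the translation invariant law mu of w, its
    logarithm is a function of the window L - x alone. Since nu is Gibbs, the
    two probabilities are, up to a common factor, averages of the kernel at the
    single site 0 over the configurations that agree inside the window with w
    before 0 and with + after 0 ([spin_sandwich]). Non-nullness bounds the
    logarithm, and, because mu-almost every w has its past followed by + as a
    continuity point, it converges as the window grows ([spin_ratio_cvg]) to a
    quantity that depends only on w and on the specification. Dominated
    convergence carries the limit through the mu-integral
    ([cross_log_increment_cvg]).

    All but a vanishing fraction of the sites of a large box see a large window
    around them, so the sum over x of such terms, divided by the volume, has the
    limit of a single term ([spatial_average]). Hence the mu-mean of ln (nu(w_L)
    / nu(+_L)) has a volume density c ([cross_log_density]), which is the same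
    for all translation invariant Gibbs measures nu.

    The mu-mean of ln mu(w_L), minus the entropy of mu in L, is treated by the
    same decomposition: its increments are minus the conditional entropies given
    the past, monotone in the window ([neg_entropy_fset1U_mono]) and bounded, so
    it has a density s as well ([neg_entropy_density]). Since the relative
    entropy in L is the difference of the mu-means of ln mu(w_L) and ln nu(w_L)
    ([rel_entropyE]), its density exists and equals s - c + e, where e is the
    limit of the rate of nu(+_L). When mu is itself Gibbs, the density c also
    serves for nu := mu; the two copies of c cancel, and what remains is the
    limit of the volume average of ln (mu(+_L) / nu(+_L)), which vanishes. *)

(** * Local events and functions *)

Section LocalEvents.
Context {d : nat} {E : finType} {p : E}.
Local Notation Zd := 'rV[int]_d.
Local Notation Omega := (config d p).
Implicit Types (L D : {fset Zd}) (v w : Omega) (A : set Omega).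

Definition agree (S : set Zd) v w := forall x, S x -> v x = w x.

Definition depends_on {T : Type} (S : set Zd) (f : Omega -> T) :=
  forall v w, agree S v w -> f v = f w.

(** The sets containing all configurations that agree with w on some finite set
    of sites form a filter that converges to w at each site, hence to w in the
    product topology; conversely finitely many coordinates are continuous. *)
Lemma nbhs_agreeP w A :
  nbhs w A <-> exists L, forall v, agree [set` L] v w -> A v.
Proof.
split=> [|[L LA]].
  pose F A := exists L, forall v, agree [set` L] v w -> A v.
  have FF : Filter F.
    split.
    - by exists fset0.
    - move=> P Q [L LP] [L' LQ]; exists (L `|` L')%fset => v vw; split.
        by apply: LP => x xL; apply: vw; rewrite /= inE; apply/orP; left.
      by apply: LQ => x xL; apply: vw; rewrite /= inE; apply/orP; right.
    - by move=> P Q PQ [L LP]; exists L => v /LP/PQ.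
  suff : cvg_to F (nbhs w) by apply.
  apply/(cvg_sup (fun x : Zd => Topological.class (initial_topology
    (fun f : (Zd -> discrete_topology E) => f x))) w) => x B.
  rewrite nbhsE => -[C [[U oU <-] Uw] sB].
  exists [fset x]%fset => v vw; apply: sB => /=.
  by have := vw x; rewrite /= inE => ->.
apply: (@filterS _ _ _ (\bigcap_(x in [set` L]) [set v | v x = w x])).
  by move=> v vw; apply: LA.
apply: filter_bigI => x _.
have pc := @proj_continuous Zd (fun=> discrete_topology E) x w.
by apply: (pc [set w x]); exact: discrete_set1.
Qed.

Lemma open_agreeP A : open A <->
  forall w, A w -> exists L, forall v, agree [set` L] v w -> A v.
Proof.
by rewrite openE; split=> oA w /oA /nbhs_agreeP.
Qed.

Lemma depends_on_open L A : depends_on [set` L] A -> open A.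
Proof.
move=> LA; apply/open_agreeP => w Aw; exists L => v vw.
by rewrite (LA v w vw).
Qed.

Lemma open_measurable_config A : open A -> measurable A.
Proof. by move=> oA; apply: sub_sigma_algebra. Qed.

Lemma depends_on_measurable L A : depends_on [set` L] A -> measurable A.
Proof. by move=> /depends_on_open/open_measurable_config. Qed.

Lemma measurable_depends_on d' (T : measurableType d') L (f : Omega -> T) :
  depends_on [set` L] f -> measurable_fun setT f.
Proof.
move=> Lf _ B _; rewrite setTI; apply: (@depends_on_measurable L) => v w vw.
by rewrite /preimage /= (Lf v w vw).
Qed.

Lemma depends_on_comp {T U : Type} (S : set Zd) (f : Omega -> T) (h : T -> U) :
  depends_on S f -> depends_on S (h \o f).
Proof. by move=> Sf v w vw /=; rewrite (Sf v w vw). Qed.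

Lemma restrP L v w : restr L v = restr L w <-> agree [set` L] v w.
Proof.
split=> [/ffunP vw x xL|vw].
  by have := vw [` xL]%fset; rewrite !ffunE.
by apply/ffunP => x; rewrite !ffunE; apply: vw; exact: valP.
Qed.

Lemma depends_on_restr L : depends_on [set` L] (@restr d E p L).
Proof. by move=> v w /restrP. Qed.

Definition extend L (s : {ffun L -> E}) : Omega :=
  fun x => if insub x is Some y then s y else p.

Lemma restr_extend L (s : {ffun L -> E}) : restr L (extend s) = s.
Proof. by apply/ffunP => x; rewrite ffunE /extend valK. Qed.

Lemma measurable_cylinder L (s : {ffun L -> E}) :
  measurable (cylinder (p := p) s).
Proof.
apply: (@depends_on_measurable L) => v w vw.
by rewrite /cylinder /= (depends_on_restr vw).
Qed.

(** Reading finitely many coordinates at each site makes a map continuous. *)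
Lemma measurable_config_map (T : Omega -> Omega) :
  (forall x, exists L, depends_on [set` L] (fun w => T w x)) ->
  measurable_fun setT T.
Proof.
move=> loc; apply: (@measurability _ _ _ _ setT T (@open Omega)) => //.
move=> _ [A oA <-]; rewrite setTI; apply: open_measurable_config.
have {loc}[S TS] := choice loc.
apply/open_agreeP => w; move=> /((open_agreeP A).1 oA)[L LA].
exists (\bigcup_(x <- L) S x)%fset => v vw.
apply: LA => x xL; apply: TS => y yS; apply: vw => /=.
by apply/bigfcupP; exists x; rewrite ?andbT.
Qed.

Lemma measurable_shift (x : Zd) : measurable_fun setT (@Defs.shift d E p x).
Proof.
apply: measurable_config_map => y; exists [fset (x + y)%R]%fset => v w; apply.
by rewrite /= inE.
Qed.

Lemma measurable_plus_future : measurable_fun setT (@plus_future d E p).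
Proof.
apply: measurable_config_map => x; exists [fset x]%fset => v w vw.
by rewrite /plus_future vw //= inE.
Qed.

(** Events of the coordinate sigma-field of D are blind to the other sites,
    because the events with that property form a sigma-algebra. *)
Lemma coord_sigma_depends_on (D : set Zd) A :
  <<s coord_events (p := p) D >> A -> depends_on D A.
Proof.
apply: (@smallest_sub _ _ _ [set A | depends_on D A]).
  split.
  - by move=> v w _.
  - by move=> B DB v w vw; rewrite /setD /= (DB v w vw).
  - move=> F DF v w vw; rewrite /bigcup /=; apply/propext.
    by split=> -[i _]; [rewrite (DF i v w vw)|rewrite -(DF i v w vw)]; exists i.
by move=> B /= [x Dx [C ->]] v w vw; rewrite /= (vw x Dx).
Qed.

Lemma coord_sigma_sub (D : set Zd) A :
  <<s coord_events (p := p) D >> A -> measurable A.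
Proof.
apply: smallest_sub; first exact: sigma_algebra_measurable.
move=> B /= [x _ [C ->]]; apply: (@depends_on_measurable [fset x]%fset).
by move=> v w vw /=; rewrite vw //= inE.
Qed.

Lemma coord_measurable_fun_depends_on (R : realType) (D : set Zd)
    (f : Omega -> \bar R) :
  @measurable_fun _ _ (coord_space p D) _ setT f -> depends_on D f.
Proof.
move=> mf v w vw.
have /= := mf measurableT [set f w] (emeasurable_set1 _).
rewrite setTI => /coord_sigma_depends_on/(_ v w vw).
by rewrite /preimage /= => vwE; rewrite vwE.
Qed.

Lemma coord_measurable_fun_sub d' (T : measurableType d') (D : set Zd)
    (f : Omega -> T) :
  @measurable_fun _ _ (coord_space p D) _ setT f -> measurable_fun setT f.
Proof.
move=> mf _ B mB; rewrite setTI; apply: (@coord_sigma_sub D).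
by rewrite -[X in <<s _ >> X]setTI; exact: mf.
Qed.

Lemma agree_coord_event (D : set Zd) L w : [set` L] `<=` D ->
  <<s coord_events (p := p) D >> [set v | agree [set` L] v w].
Proof.
move=> LD.
have -> : [set v : Omega | agree [set` L] v w] =
   \bigcap_(x in [set` L]) [set v | v x = w x] by [].
apply: (@fin_bigcap_measurable _ (coord_space p D)) => [|x xL].
  exact: finite_fset.
apply: sub_sigma_algebra; exists x; first exact: LD.
by exists [set w x].
Qed.

End LocalEvents.

(** * Lexicographic order, boxes and spatial averages *)

Section Lattice.
Context {d : nat}.
Local Notation Zd := 'rV[int]_d.
Implicit Types (L A : {fset Zd}) (x y z : Zd).

Lemma lex_le_refl x : lex_le x x.
Proof. exact: lexx. Qed.

Lemma lex_le_anti x y : lex_le x y -> lex_le y x -> x = y.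
Proof.
move=> xy yx; have /eqP : ([tuple x 0 i | i < d] : d.-tuplelexi int) =
  ([tuple y 0 i | i < d] : d.-tuplelexi int).
  by apply: le_anti; rewrite [X in X && _]xy.
move=> /eqP xyE; apply/matrixP => i j; rewrite !ord1.
by have := congr1 (fun t => tnth t j) xyE; rewrite !tnth_mktuple.
Qed.

Lemma lex_le_add x y z : lex_le (x + z) (y + z) = lex_le x y.
Proof.
rewrite /lex_le; apply/lexi_tupleP/lexi_tupleP => -[k kP]; exists k => i ik;
  have := kP i ik; rewrite !tnth_mktuple !mxE /Order.leif lerD2r;
  by rewrite (inj_eq (addIr _)).
Qed.

Lemma lex_max L : L != fset0 ->
  exists2 x, x \in L & forall y, y \in L -> lex_le y x.
Proof.
move=> /fset0Pn[x0 x0L].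
pose f (y : L) : d.-tuplelexi int := [tuple fsval y 0 i | i < d].
pose m := [arg max_(y > [` x0L]%fset | predT y) f y]%O.
exists (fsval m); first exact: valP.
move=> y yL; rewrite /m; case: arg_maxP => //= z _ /(_ [` yL]%fset isT).
exact.
Qed.

Definition before L x := [fset y in L | lex_le y x]%fset.
Definition past L := before L 0.

(** Deleting the greatest site m of L changes none of the sets [before L x] for
    the other x, and the term of m is G L - G (L minus m). *)
Lemma sum_increments (R : zmodType) (G : {fset Zd} -> R) L :
  \sum_(x <- L) (G (before L x) - G (before L x `\ x)%fset) = G L - G fset0.
Proof.
have [n] := ubnP #|` L|; elim: n L => // n IH L Ln.
have [->|L0] := eqVneq L fset0; first by rewrite big_seq_fset0 subrr.
have [m mL mmax] := lex_max L0.
have mE : before L m = L.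
  by apply/fsetP => y; rewrite !inE /=; case yL: (y \in L) => //=; exact: mmax.
rewrite (big_fsetD1 m) //= mE [in X in _ + X]big_seq.
rewrite (eq_bigr (fun x => G (before (L `\ m)%fset x) -
    G (before (L `\ m) x `\ x)%fset)).
  rewrite -big_seq IH; first by rewrite addrA subrK.
  by move: Ln; rewrite (cardfsD1 m L) mL.
move=> x; rewrite !inE => /andP[xm xL].
suff -> : before L x = before (L `\ m)%fset x by [].
apply/fsetP => y; rewrite !inE /=; have [->|//] := eqVneq y m.
rewrite mL /=; apply/negP => /lex_le_anti /(_ (mmax x xL)) mx.
by rewrite mx eqxx in xm.
Qed.

Lemma mem_translate L x y : (y \in translate L x) = (y - x \in L).
Proof.
apply/imfsetP/idP => /= [[z zL ->]|yL]; first by rewrite addrK.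
by exists (y - x); rewrite ?subrK.
Qed.

Lemma translateK L x : translate (translate L x) (- x) = L.
Proof. by apply/fsetP => y; rewrite !mem_translate opprK addrK. Qed.

Lemma before_translate L x :
  before L x = translate (past (translate L (- x))) x.
Proof.
apply/fsetP => y; rewrite mem_translate !inE /= mem_translate opprK subrK.
by rewrite -(lex_le_add _ 0 x) subrK add0r.
Qed.

Lemma fsetD1_translate L x y :
  (translate L x `\ y)%fset = translate (L `\ (y - x))%fset x.
Proof.
by apply/fsetP => z; rewrite !(mem_translate, inE) (inj_eq (addIr _)).
Qed.

Definition increment (R : zmodType) (G : {fset Zd} -> {fset Zd} -> R) L :=
  G L (past L) - G L (past L `\ 0)%fset.

(** Moving x to the origin makes each term of the telescoping sum a fixed
    function of the window as it is seen from x. *)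
Lemma sum_increments_translate (R : zmodType)
    (G : {fset Zd} -> {fset Zd} -> R) :
  (forall L A x, G (translate L x) (translate A x) = G L A) -> forall L,
  \sum_(x <- L) increment G (translate L (- x)) = G L L - G L fset0.
Proof.
move=> Ginv L; rewrite -(sum_increments (G L)); apply: eq_bigr => x _.
have GL A : G L (translate A x) = G (translate L (- x)) A.
  by rewrite -[in LHS](translateK L (- x)) opprK Ginv.
by rewrite before_translate fsetD1_translate subrr !GL.
Qed.

Lemma mem_box n x : (x \in box d n) = [forall i, `|x 0 i|%R <= n%:Z].
Proof.
apply/imfsetP/forallP => /= [[k _ ->] i|xn].
  by rewrite mxE; have := ltn_ord (k i); lia.
exists [ffun i => inord (absz (x 0 i + n%:Z))] => //.
apply/rowP => i; rewrite mxE ffunE inordK; first by have := xn i; lia.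
by have := xn i; lia.
Qed.

Lemma card_box n : #|` box d n| = (n.*2.+1 ^ d)%N.
Proof.
rewrite card_imfset /=; last first.
  move=> k l /rowP kl; apply/ffunP => i; apply/val_inj => /=.
  by have := kl i; rewrite !mxE; lia.
by rewrite -cardE card_ffun !card_ord.
Qed.

Lemma card_box_gt0 n : (0 < #|` box d n|)%N.
Proof. by rewrite card_box expn_gt0. Qed.

Lemma mem0_box n : 0 \in box d n.
Proof. by rewrite mem_box; apply/forallP => i; rewrite mxE normr0. Qed.

Lemma box_mono m n : (m <= n)%N -> (box d m `<=` box d n)%fset.
Proof.
move=> mn; apply/fsubsetP => x; rewrite !mem_box => /forallP xm.
by apply/forallP => i; have := xm i; lia.
Qed.

Lemma sub_box L : exists n, (L `<=` box d n)%fset.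
Proof.
pose r (x : Zd) := (\max_i absz (x 0%R i))%N.
exists (\max_(x <- L) r x)%N; apply/fsubsetP => x xL.
rewrite mem_box; apply/forallP => i.
have h1 : (absz (x 0%R i) <= r x)%N by exact: (leq_bigmax i).
have h2 : (r x <= \max_(x <- L) r x)%N by exact: leq_bigmax_seq.
by rewrite -abszE lez_nat (leq_trans h1 h2).
Qed.

Lemma box_sub_translate m n x : (m <= n)%N -> x \in box d (n - m) ->
  (box d m `<=` translate (box d n) (- x))%fset.
Proof.
move=> mn; rewrite mem_box => /forallP xnm; apply/fsubsetP => y.
rewrite mem_translate !mem_box => /forallP ym; apply/forallP => i.
rewrite !mxE opprK (le_trans (ler_normD _ _)) // -(subnKC mn) PoszD.
by rewrite lerD.
Qed.

Lemma card_box_ratio_cvg (R : realType) (m : nat) :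
  (#|` box d (n - m)|%:R / #|` box d n|%:R : R) @[n --> \oo] --> (1 : R).
Proof.
have base : ((n - m).*2.+1%:R / n.*2.+1%:R : R) @[n --> \oo] --> (1 : R).
  apply/cvgrPdist_le => e e0; near=> n.
  have mn : (m <= n)%N by near: n; exact: nbhs_infty_ge.
  have n0 : (0 : R) < n.*2.+1%:R by rewrite ltr0n.
  have -> : 1 - (n - m).*2.+1%:R / n.*2.+1%:R = m.*2%:R / n.*2.+1%:R :> R.
    rewrite -{1}(@divff _ (n.*2.+1%:R : R)) ?gt_eqF// -mulrBl -natrB.
      by congr (_%:R / _); lia.
    by lia.
  rewrite ger0_norm ?divr_ge0 // ler_pdivrMr //.
  have : m.*2%:R / e <= n%:R by near: n; exact: nbhs_infty_ger.
  rewrite ler_pdivrMr // => /le_trans; apply; rewrite mulrC ler_pM2l //.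
  by rewrite ler_nat; lia.
have := cvg_comp _ _ base (@exprn_continuous R d 1).
rewrite expr1n; apply: cvg_trans; apply: near_eq_cvg; near=> n.
by rewrite /= !card_box !natrX -expr_div_n.
Unshelve. all: by end_near. Qed.

(** The sites x in the box of radius n - m form almost all of the box of radius
    n, and there the window seen from x contains the box of radius m; the
    remaining sites contribute a bounded amount each. *)
Lemma spatial_average (R : realType) (phi : {fset Zd} -> R) (K c : R) :
  (forall L, 0 \in L -> `|phi L| <= K) ->
  (forall e : R, 0 < e ->
     exists m, forall L, (box d m `<=` L)%fset -> `|phi L - c| <= e) ->
  (#|` box d n|%:R^-1 * \sum_(x <- box d n) phi (translate (box d n) (- x)))
    @[n --> \oo] --> c.
Proof.
move=> phiK phic; apply/cvgrPdist_le => e e0.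
have e20 : 0 < e / 2 by rewrite divr_gt0.
have [m mP] := phic _ e20.
pose M := `|K| + `|c| + 1.
have M0 : 0 < M by rewrite ltr_wpDl // addr_ge0.
have := @card_box_ratio_cvg R m.
move/cvgrPdist_le => /(_ (e / 2 / M)); rewrite divr_gt0 // => /(_ isT) rat.
near=> n.
have mn : (m <= n)%N by near: n; exact: nbhs_infty_ge.
have B0 : (0 : R) < #|` box d n|%:R by rewrite ltr0n card_box_gt0.
have ratn : `|1 - #|` box d (n - m)|%:R / #|` box d n|%:R| <= e / 2 / M.
  by near: n.
have phix x : x \in box d n -> `|phi (translate (box d n) (- x)) - c| <=
    e / 2 + M * (x \notin box d (n - m))%:R.
  move=> xn; have [xb|xb] /= := boolP (x \in _).
    by rewrite mulr0 addr0; apply: mP; exact: box_sub_translate.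
  rewrite mulr1 (le_trans (ler_normB _ _)) //.
  have : `|phi (translate (box d n) (- x))| <= K.
    by apply: phiK; rewrite mem_translate opprK add0r.
  by rewrite /M; have := ler_norm K; lra.
have -> : c - #|` box d n|%:R^-1 *
      \sum_(x <- box d n) phi (translate (box d n) (- x)) =
    - (#|` box d n|%:R^-1 *
      \sum_(x <- box d n) (phi (translate (box d n) (- x)) - c)).
  rewrite sumrB big_const_seq count_predT iter_addr_0 -[c *+ _]mulr_natl mulrBr.
  by rewrite mulKf ?gt_eqF // opprB.
rewrite normrN normrM gtr0_norm ?invr_gt0 // mulrC ler_pdivrMr //.
apply: le_trans (ler_norm_sum _ _ _) _.
apply: le_trans (_ : \sum_(x <- box d n) (e / 2 +
    M * (x \notin box d (n - m))%:R) <= _).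
  by rewrite big_seq [leRHS]big_seq; apply: ler_sum => x; exact: phix.
have cnt : \sum_(x <- box d n) (x \notin box d (n - m))%:R =
    #|` box d n|%:R - #|` box d (n - m)|%:R :> R.
  have nmn : (box d (n - m) `<=` box d n)%fset by apply: box_mono; lia.
  rewrite -natr_sum -natrB ?fsubset_leq_card //; congr (_%:R).
  rewrite -(cardfsDS nmn) (eq_bigr (fun x =>
    if x \notin box d (n - m) then 1%N else 0%N)).
    2: by move=> x _; case: ifP.
  rewrite -big_mkcond sum1_count -size_filter; apply/perm_size/uniq_perm.
  - by rewrite filter_uniq // fset_uniq.
  - exact: fset_uniq.
  - by move=> x; rewrite mem_filter inE.
rewrite big_split /= -[X in _ + X]mulr_sumr cnt.
rewrite big_const_seq count_predT iter_addr_0.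
rewrite -[X in X + _]mulr_natr.
have -> : #|` box d n|%:R - #|` box d (n - m)|%:R =
  (1 - #|` box d (n - m)|%:R / #|` box d n|%:R) * #|` box d n|%:R :> R.
  by rewrite mulrBl mul1r divfK ?gt_eqF.
rewrite mulrA -mulrDl ler_pM2r //.
have := le_trans (ler_norm _) ratn; rewrite ler_pdivlMr // => h.
by rewrite mulrC; lra.
Unshelve. all: by end_near. Qed.

End Lattice.

(** * Integrals of local functions and entropies of finite windows *)

Section LocalIntegrals.
Context {R : realType} {d : nat} {E : finType} {p : E}.
Local Notation Zd := 'rV[int]_d.
Local Notation Omega := (config d p).
Implicit Types (L A B : {fset Zd}) (v w : Omega) (mu nu : probability Omega R).

Lemma bounded_integrable d' (T : measurableType d')
    (m : {measure set T -> \bar R}) (f : T -> R) (K : R) :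
  (m setT < +oo)%E -> measurable_fun setT f -> (forall x, `|f x| <= K) ->
  m.-integrable setT (EFin \o f).
Proof.
move=> mT mf fK; apply: measurable_bounded_integrable => //.
exists K; split; first exact: num_real.
by move=> M KM x _; exact: le_trans (fK x) (ltW KM).
Qed.

Lemma integrable_local (m : {measure set Omega -> \bar R}) L (f : Omega -> R) :
  (m setT < +oo)%E -> depends_on [set` L] f ->
  m.-integrable setT (EFin \o f).
Proof.
move=> mT Lf.
pose K := \sum_(s : {ffun L -> E}) `|f (extend s)|.
apply: (@bounded_integrable _ _ _ _ K) => //.
  exact: measurable_depends_on Lf.
move=> w; rewrite /K (bigD1 (restr L w)) //=.
rewrite (Lf (extend _) w) ?lerDl ?sumr_ge0 //.
by apply/restrP; rewrite restr_extend.
Qed.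

Lemma Rintegral_finite_valued (m : {measure set Omega -> \bar R}) (T : finType)
    L (X : Omega -> T) (F : T -> R) :
  (m setT < +oo)%E -> depends_on [set` L] X ->
  \int[m]_w F (X w) = \sum_t fine (m (X @^-1` [set t])) * F t.
Proof.
move=> mT LX.
have mX t : measurable (X @^-1` [set t]).
  apply: (@depends_on_measurable _ _ _ L) => v w vw.
  by rewrite /preimage /= (LX v w vw).
have mXoo t : (m (X @^-1` [set t]) < +oo)%E.
  by apply: le_lt_trans mT; apply: le_measure; rewrite ?inE.
have iX t : m.-integrable setT (fun w => (\1_(X @^-1` [set t]) w)%:E : \bar R).
  apply: (@bounded_integrable _ _ _ (\1_(X @^-1` [set t])) 1) => //.
  by move=> w; rewrite indicE; case: (_ \in _); rewrite ?normr1 ?normr0.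
rewrite /Rintegral (eq_integral (fun w =>
    (\sum_t ((F t)%:E * (\1_(X @^-1` [set t]) w)%:E))%E)); last first.
  move=> w _; rewrite (bigD1 (X w)) //= big1 ?adde0.
    by rewrite indicE mem_set // mule1.
  move=> t tX; rewrite indicE memNset ?mule0 // => /esym/eqP.
  by rewrite (negPf tX).
rewrite integral_sum //; last by move=> t; exact: integrableZl.
rewrite -sum_fine /=; last first.
  move=> t _; rewrite integralZl // integral_indic // setIT.
  by rewrite fin_numM // ge0_fin_numE.
apply: eq_bigr => t _; rewrite integralZl // integral_indic // setIT.
rewrite fineM //=; last by rewrite ge0_fin_numE.
by rewrite mulrC.
Qed.

Lemma probability_lty mu : (mu setT < +oo)%E.
Proof. by rewrite probability_setT ltry. Qed.

Definition window_prob mu L w : R := pattern_prob mu (restr L w).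

Lemma window_probE mu L w :
  (window_prob mu L w)%:E = mu [set v | agree [set` L] v w].
Proof.
rewrite /window_prob /pattern_prob fineK ?fin_num_measure //.
  by congr (mu _); apply/seteqP; split=> v /restrP.
exact: measurable_cylinder.
Qed.

Lemma window_prob_depends_on mu L : depends_on [set` L] (window_prob mu L).
Proof. by move=> v w /restrP vw; rewrite /window_prob vw. Qed.

Lemma measurable_agree L w : measurable [set v : Omega | agree [set` L] v w].
Proof.
apply: (@depends_on_measurable _ _ _ L) => u v uv; apply/propext.
by split=> h x xL; rewrite -h // uv.
Qed.

Lemma window_prob0 mu w : window_prob mu fset0 w = 1.
Proof.
apply/EFin_inj; rewrite window_probE -(@probability_setT _ _ _ mu).
by congr (mu _); apply/seteqP; split=> v.
Qed.

Lemma window_prob_translate mu L x w : translation_invariant mu ->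
  window_prob mu (translate L x) w = window_prob mu L (Defs.shift x w).
Proof.
move=> inv; apply/EFin_inj; rewrite !window_probE -[RHS](inv x); last first.
  exact: measurable_agree.
congr (mu _); apply/seteqP; split=> v vw y /=.
  move=> yL; rewrite /Defs.shift; apply: vw.
  by rewrite /= mem_translate addrAC subrr add0r.
rewrite mem_translate => yL; have := vw _ yL.
by rewrite /Defs.shift addrC subrK.
Qed.

Lemma Rintegral_shift mu L (f : Omega -> R) x : translation_invariant mu ->
  depends_on [set` L] f -> \int[mu]_w f (Defs.shift x w) = \int[mu]_w f w.
Proof.
move=> inv Lf.
have mf := measurable_depends_on Lf; have ms := @measurable_shift d E p x.
have Lfs : depends_on [set` translate L x] (f \o @Defs.shift d E p x).
  move=> v w vw; apply: Lf => y yL; apply: vw.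
  by rewrite /= mem_translate addrAC subrr add0r.
rewrite /Rintegral; congr fine.
rewrite [RHS](@eq_measure_integral _ _ _ _
  (pushforward mu (@Defs.shift d E p x))).
  rewrite integral_pushforward //; first exact/measurable_EFinP.
  by rewrite preimage_setT; exact: (integrable_local (probability_lty mu) Lfs).
by move=> A mA _; exact/esym/inv.
Qed.

Definition plus_outside A w : Omega := fun x => if x \in A then w x else p.

Lemma depends_on_plus_outside {T : Type} A (f : Omega -> T) :
  depends_on [set` A] (f \o plus_outside A).
Proof.
move=> v w vw /=; congr f; apply/funext => x; rewrite /plus_outside.
by case: ifP => // xA; exact: vw.
Qed.

Lemma shift_plus_outside A x w :
  Defs.shift x (plus_outside (translate A x) w) =
  plus_outside A (Defs.shift x w).
Proof.
apply/funext => y; rewrite /Defs.shift /plus_outside mem_translate.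
by rewrite addrAC subrr add0r.
Qed.

Definition neg_entropy mu A : R := \int[mu]_w ln (window_prob mu A w).

(** As A grows from the empty set to L, this goes from ln nu(+_L) to the mu-mean
    of ln nu(w_L), each site added to A turning one + into the spin of w. *)
Definition cross_log mu nu L A : R :=
  \int[mu]_w ln (window_prob nu L (plus_outside A w)).

Lemma neg_entropy_translate mu A x : translation_invariant mu ->
  neg_entropy mu (translate A x) = neg_entropy mu A.
Proof.
move=> inv; rewrite /neg_entropy.
under eq_Rintegral do rewrite window_prob_translate //.
apply: (Rintegral_shift (L := A)) => //.
by apply: (depends_on_comp (@ln R)); exact: window_prob_depends_on.
Qed.

Lemma cross_log_translate mu nu L A x :
  translation_invariant mu -> translation_invariant nu ->
  cross_log mu nu (translate L x) (translate A x) = cross_log mu nu L A.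
Proof.
move=> muinv nuinv; rewrite /cross_log.
under eq_Rintegral do rewrite window_prob_translate // shift_plus_outside.
apply: (Rintegral_shift (L := A)
  (f := fun w => ln (window_prob nu L (plus_outside A w)))) => //.
exact: (@depends_on_plus_outside _ A (fun w => ln (window_prob nu L w))).
Qed.

Lemma neg_entropy0 mu : neg_entropy mu fset0 = 0.
Proof.
rewrite /neg_entropy; under eq_Rintegral do rewrite window_prob0 ln1.
by rewrite Rintegral_cst // mul0r.
Qed.

Lemma cross_log0 mu nu L : cross_log mu nu L fset0 = ln (plus_prob nu L).
Proof.
rewrite /cross_log (_ : (fun w => _) = fun=> ln (plus_prob nu L)); last first.
  by apply/funext => w; congr (ln (window_prob nu L _)); apply/funext.
by rewrite Rintegral_cst // [X in fine X]probability_setT mulr1.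
Qed.

Lemma cross_log_self mu nu L :
  cross_log mu nu L L = \int[mu]_w ln (window_prob nu L w).
Proof.
apply: eq_Rintegral => w _; congr ln.
by apply: window_prob_depends_on => x /= xL; rewrite /plus_outside xL.
Qed.

Lemma cross_log_diag mu L : cross_log mu mu L L = neg_entropy mu L.
Proof. exact: cross_log_self. Qed.

Lemma Rintegral_window mu L (F : {ffun L -> E} -> R) :
  \int[mu]_w F (restr L w) = \sum_s pattern_prob mu s * F s.
Proof.
exact: Rintegral_finite_valued (probability_lty mu) (depends_on_restr (L := L)).
Qed.

(** Positivity of nu on patterns makes all marginals absolutely continuous with
    respect to those of nu and lets the logarithm of the quotient be split;
    patterns that are null for mu contribute 0 to both sides. *)
Lemma rel_entropyE mu nu L : (forall w, 0 < window_prob nu L w) ->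
  rel_entropy L mu nu = (neg_entropy mu L - cross_log mu nu L L)%:E.
Proof.
move=> nu_gt0.
have nus s : 0 < pattern_prob nu (s : {ffun L -> E}).
  by have := nu_gt0 (extend s); rewrite /window_prob restr_extend.
rewrite /rel_entropy asboolT; last first.
  move=> S nuS; suff -> : S = set0 by rewrite preimage_set0 measure0.
  apply/seteqP; split=> // s Ss; have := nus s.
  suff : pattern_prob nu s <= 0 by lra.
  rewrite -lee_fin /pattern_prob fineK ?fin_num_measure //; last first.
    exact: measurable_cylinder.
  have : (nu (cylinder s) <= nu (@restr d E p L @^-1` S))%E.
    apply: le_measure; rewrite ?inE; first exact: measurable_cylinder.
      apply: (@depends_on_measurable _ _ _ L) => v w /depends_on_restr vw.
      by rewrite /preimage /= vw.
    by move=> w; rewrite /cylinder /preimage /= => ->.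
  by rewrite nuS.
rewrite cross_log_self /neg_entropy /window_prob.
rewrite (Rintegral_window mu (fun s => ln (pattern_prob mu s))).
rewrite (Rintegral_window mu (fun s => ln (pattern_prob nu s))).
rewrite -sumrB; congr EFin; apply: eq_bigr => s _; rewrite -mulrBr.
have [->|mus] := eqVneq (pattern_prob mu s) 0; first by rewrite !mul0r.
rewrite ln_div // ?posrE //.
by rewrite lt_neqAle eq_sym mus /=; apply: fine_ge0.
Qed.

End LocalIntegrals.

(** * Entropy per site *)

(** Conditioning decreases entropy: with m the joint law of (u, e), the
    conditional entropy of e given u is at most that of e given f u. Bounding
    each logarithm by ln t <= t - 1 leaves a difference of two total masses. *)
Lemma finite_conditional_entropy (R : realType) (U V F : finType) (f : U -> V)
    (m : U -> F -> R) (M : U -> R) (n : V -> F -> R) (N : V -> R) :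
  (forall u e, 0 <= m u e) ->
  (forall u, M u = \sum_e m u e) ->
  (forall v e, n v e = \sum_(u | f u == v) m u e) ->
  (forall v, N v = \sum_e n v e) ->
  \sum_u \sum_e m u e * (ln (n (f u) e) - ln (N (f u))) <=
  \sum_u \sum_e m u e * (ln (m u e) - ln (M u)).
Proof.
move=> m0 ME nE NE; rewrite -subr_le0 -sumrB.
have M0 u : 0 <= M u by rewrite ME sumr_ge0.
have n0 v e : 0 <= n v e by rewrite nE sumr_ge0.
have N0 v : 0 <= N v by rewrite NE sumr_ge0.
have mM u e : m u e <= M u.
  by rewrite ME (bigD1 e) //= lerDl sumr_ge0.
have mn u e : m u e <= n (f u) e.
  by rewrite nE (bigD1 u) //= lerDl sumr_ge0.
have nN v e : n v e <= N v.
  by rewrite NE (bigD1 e) //= lerDl sumr_ge0.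
apply: le_trans (_ : \sum_u (M u * (N (f u) / N (f u)) - M u) <= _); last first.
  apply: sumr_le0 => u _; rewrite subr_le0.
  have [->|Nu] := eqVneq (N (f u)) 0; first by rewrite mul0r mulr0.
  by rewrite divff // mulr1.
apply: ler_sum => u _; rewrite -sumrB.
have -> : M u * (N (f u) / N (f u)) - M u =
    \sum_e (M u * (n (f u) e / N (f u)) - m u e).
  by rewrite sumrB -ME -mulr_sumr -mulr_suml -NE.
apply: ler_sum => e _; rewrite -mulrBr.
have [mue0|mue] := eqVneq (m u e) 0.
  by rewrite mue0 mul0r subr0 mulr_ge0 // divr_ge0.
have {}mue : 0 < m u e by rewrite lt_neqAle eq_sym mue m0.
have Mu := lt_le_trans mue (mM u e).
have nu := lt_le_trans mue (mn u e).
have Nu := lt_le_trans nu (nN _ e).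
rewrite -[leLHS](_ : m u e * ln (M u * (n (f u) e / N (f u)) / m u e) = _).
  set t := M u * (n (f u) e / N (f u)).
  have t0 : 0 < t by rewrite mulr_gt0 // divr_gt0.
  have -> : t - m u e = m u e * (t / m u e - 1).
    by rewrite mulrBr mulr1 mulrC divfK // gt_eqF.
  rewrite ler_pM2l //.
  have -> : t / m u e = 1 + (t / m u e - 1) by lra.
  rewrite [leRHS](_ : _ = t / m u e - 1); last by lra.
  by apply: le_ln1Dx; have := divr_gt0 t0 mue; lra.
rewrite !(ln_div, lnM) ?posrE ?mulr_gt0 ?divr_gt0 ?invr_gt0 //.
by congr (_ * _); lra.
Qed.

Section EntropyIncrements.
Context {R : realType} {d : nat} {E : finType} {p : E}.
Local Notation Zd := 'rV[int]_d.
Local Notation Omega := (config d p).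
Implicit Types (L A B : {fset Zd}) (v w : Omega).
Variable mu : probability Omega R.

Definition law (T : finType) (X : Omega -> T) (t : T) : R :=
  fine (mu (X @^-1` [set t])).

Lemma law_ge0 (T : finType) (X : Omega -> T) t : 0 <= law X t.
Proof. exact: fine_ge0. Qed.

Lemma Rintegral_law (T : finType) L (X : Omega -> T) (F : T -> R) :
  depends_on [set` L] X -> \int[mu]_w F (X w) = \sum_t law X t * F t.
Proof. exact: (Rintegral_finite_valued _ (probability_lty mu)). Qed.

(** Both sides integrate the indicator of {h (X w) = u}. *)
Lemma law_comp (T U : finType) L (X : Omega -> T) (h : T -> U) u :
  depends_on [set` L] X ->
  law (h \o X) u = \sum_(t | h t == u) law X t.
Proof.
move=> LX; pose F (t : U) : R := (t == u)%:R.
have := Rintegral_law (fun t => F (h t)) LX.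
rewrite (Rintegral_law (X := h \o X) F (depends_on_comp h LX)).
rewrite (bigD1 u) //= big1 => [|t tu]; last by rewrite /F (negPf tu) mulr0.
rewrite addr0 /F eqxx mulr1 => ->; rewrite [RHS]big_mkcond.
by apply: eq_bigr => t _; case: ifP; rewrite ?mulr1 ?mulr0.
Qed.

Definition pattern_at A x w : {ffun A -> E} * E := (restr A w, w x).

Lemma depends_on_pattern_at A x :
  depends_on [set` (x |` A)%fset] (pattern_at A x).
Proof.
move=> v w vw; rewrite /pattern_at vw; last by rewrite /= !inE eqxx.
by congr (_, _); apply/restrP => y yA; apply: vw; rewrite /= !inE yA orbT.
Qed.

Lemma window_prob_fset1U A x w :
  window_prob mu (x |` A)%fset w = law (pattern_at A x) (pattern_at A x w).
Proof.
rewrite /window_prob /pattern_prob /law; congr (fine (mu _)).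
apply/seteqP; split=> v /=; first by move=> /restrP /depends_on_pattern_at.
case=> /restrP vw vx; apply/restrP => y /=; rewrite !inE => /orP[/eqP->//|].
exact: vw.
Qed.

Lemma law_restr_sum A x (s : {ffun A -> E}) :
  law (restr A) s = \sum_e law (pattern_at A x) (s, e).
Proof.
rewrite -[LHS]/(law (fst \o pattern_at A x) s).
rewrite (law_comp _ _ (@depends_on_pattern_at A x)).
rewrite (eq_bigl (fun t => (t.1 == s) && true)).
  2: by case=> *; rewrite andbT.
rewrite (eq_bigr (fun t => law (pattern_at A x) (t.1, t.2))); last by case.
rewrite -(pair_big (fun s' => s' == s) xpredT
  (fun s' e => law (pattern_at A x) (s', e))).
by rewrite big_pred1_eq.
Qed.

Lemma neg_entropy_fset1U A x :
  neg_entropy mu (x |` A)%fset - neg_entropy mu A =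
  \sum_s \sum_e law (pattern_at A x) (s, e) *
     (ln (law (pattern_at A x) (s, e)) - ln (law (restr A) s)).
Proof.
rewrite pair_big /= /neg_entropy.
under eq_Rintegral do rewrite window_prob_fset1U.
rewrite (Rintegral_law (fun t => ln (law (pattern_at A x) t))
  (@depends_on_pattern_at A x)).
rewrite (Rintegral_law (fun t => ln (law (restr A) t.1))
  (@depends_on_pattern_at A x)).
by rewrite -sumrB; apply: eq_bigr => -[s e] _ /=; rewrite mulrBr.
Qed.

Lemma neg_entropy_fset1U_le A x :
  neg_entropy mu (x |` A)%fset <= neg_entropy mu A.
Proof.
rewrite -subr_le0 neg_entropy_fset1U; apply: sumr_le0 => s _.
apply: sumr_le0 => e _.
have le_law : law (pattern_at A x) (s, e) <= law (restr A) s.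
  rewrite (law_restr_sum x) (bigD1 e) //= lerDl sumr_ge0 // => *.
  exact: law_ge0.
have [->|l0] := eqVneq (law (pattern_at A x) (s, e)) 0; first by rewrite mul0r.
have {}l0 : 0 < law (pattern_at A x) (s, e).
  by rewrite lt_neqAle eq_sym l0 law_ge0.
apply: mulr_ge0_le0; first exact: ltW.
by rewrite subr_le0 ler_ln ?posrE // (lt_le_trans l0).
Qed.

(** [finite_conditional_entropy] for the joint law of the pattern on B and the
    spin at x, f being the restriction of patterns from B to A. *)
Lemma neg_entropy_fset1U_mono A B x : (A `<=` B)%fset ->
  neg_entropy mu (x |` A)%fset - neg_entropy mu A <=
  neg_entropy mu (x |` B)%fset - neg_entropy mu B.
Proof.
move=> AB; rewrite [leRHS]neg_entropy_fset1U.
pose f (s : {ffun B -> E}) : {ffun A -> E} := restr A (extend (p := p) s).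
have fE w : f (restr B w) = restr A w.
  apply/restrP => y yA; have /restrP -> // := restr_extend (p := p) (restr B w).
  exact: (fsubsetP AB).
have XE : pattern_at A x =
    (fun t => (f t.1, t.2)) \o pattern_at B x.
  by apply/funext => w; rewrite /= fE.
have sumA a e : law (pattern_at A x) (a, e) =
    \sum_(s | f s == a) law (pattern_at B x) (s, e).
  rewrite XE (law_comp _ _ (@depends_on_pattern_at B x)).
  rewrite (eq_bigr (fun t => law (pattern_at B x) (t.1, t.2))); last by case.
  rewrite -(pair_big (fun s => f s == a) (fun e' => e' == e)
    (fun s e' => law (pattern_at B x) (s, e'))) /=.
  by apply: eq_bigr => s _; rewrite big_pred1_eq.
apply: le_trans (finite_conditional_entropy (f := f) _ _ sumA _); first last.
- exact: law_restr_sum.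
- exact: law_restr_sum.
- by move=> *; exact: law_ge0.
rewrite le_eqVlt; apply/orP; left; apply/eqP.
rewrite pair_big /= /neg_entropy.
have -> : \int[mu]_w ln (window_prob mu (x |` A)%fset w) =
    \int[mu]_w ln (law (pattern_at A x)
      (f (pattern_at B x w).1, (pattern_at B x w).2)).
  by apply: eq_Rintegral => w _; rewrite window_prob_fset1U /pattern_at /= fE.
rewrite (Rintegral_law (fun t => ln (law (pattern_at A x) (f t.1, t.2)))
  (@depends_on_pattern_at B x)).
have -> : \int[mu]_w ln (window_prob mu A w) =
    \int[mu]_w ln (law (restr A) (f (pattern_at B x w).1)).
  by apply: eq_Rintegral => w _; rewrite /= fE.
rewrite (Rintegral_law (fun t => ln (law (restr A) (f t.1)))
  (@depends_on_pattern_at B x)).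
by rewrite -sumrB; apply: eq_bigr => -[s e] _ /=; rewrite mulrBr.
Qed.

Lemma fset1U_past L : 0 \in L -> (0 |` (past L `\ 0))%fset = past L.
Proof. by move=> L0; rewrite fsetD1K // !inE /= L0 lex_le_refl. Qed.

Local Notation inc L := (increment (fun=> neg_entropy mu) L).

Lemma neg_entropy_increment_mono L B : 0 \in L -> (L `<=` B)%fset ->
  inc L <= inc B.
Proof.
move=> L0 LB; rewrite /increment -fset1U_past //.
rewrite -[X in _ <= neg_entropy mu X - _]fset1U_past ?(fsubsetP LB) //.
rewrite !fsetU1K ?inE ?eqxx //.
apply: neg_entropy_fset1U_mono; apply/fsubsetP => y; rewrite !inE /=.
by case/and3P=> -> /(fsubsetP LB) -> ->.
Qed.

Lemma neg_entropy_increment_le0 L : 0 \in L -> inc L <= 0.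
Proof.
move=> L0; rewrite /increment -fset1U_past // fsetU1K ?inE ?eqxx //.
by rewrite subr_le0 neg_entropy_fset1U_le.
Qed.

Lemma neg_entropy_increment_bounded L : 0 \in L ->
  `|inc L| <= - inc [fset 0]%fset.
Proof.
move=> L0; rewrite ler0_norm ?neg_entropy_increment_le0 // lerN2.
by apply: neg_entropy_increment_mono; rewrite ?fsub1set ?inE.
Qed.

(** The increments are monotone in the window and bounded; every window that
    contains a box of radius m lies between that box and a larger one. *)
Lemma neg_entropy_increment_cvg : exists c : R, forall e : R, 0 < e ->
  exists m, forall L, (box d m `<=` L)%fset -> `|inc L - c| <= e.
Proof.
pose u n := inc (box d n).
have u_nd : nondecreasing_seq u.
  move=> m n mn; apply: neg_entropy_increment_mono; first exact: mem0_box.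
  exact: box_mono.
have u_ub : has_ubound (range u).
  by exists 0 => _ [n _ <-]; apply: neg_entropy_increment_le0; exact: mem0_box.
have ucvg := nondecreasing_cvgn u_nd u_ub.
exists (sup (range u)) => e e0.
move/cvgrPdist_le : (ucvg) => /(_ e e0)[m _ /(_ m (leqnn m))] um.
exists m => L mL.
have L0 : 0 \in L by apply: (fsubsetP mL); exact: mem0_box.
have [k kL] := sub_box L.
have h1 : u m <= inc L by apply: neg_entropy_increment_mono; rewrite ?mem0_box.
have h2 : inc L <= u k by exact: neg_entropy_increment_mono.
have h3 : u k <= sup (range u) by apply: ub_le_sup => //; exists k.
by move: um; rewrite !ler_norml => /andP[_ um]; apply/andP; split; lra.
Qed.

(** The entropy of a shift-invariant measure has a density: by the chain rule
    along the lexicographic order it is a sum of conditional entropies given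
    the past, which decrease as the window grows. *)
Lemma neg_entropy_density : translation_invariant mu ->
  exists c : R,
    (#|` box d n|%:R^-1 * neg_entropy mu (box d n)) @[n --> \oo] --> c.
Proof.
move=> inv; have [c cP] := neg_entropy_increment_cvg; exists c.
have := spatial_average neg_entropy_increment_bounded cP.
apply: cvg_trans; apply: near_eq_cvg; apply: nearW => n.
rewrite (sum_increments_translate (G := fun=> neg_entropy mu)).
  by rewrite neg_entropy0 subr0.
by move=> _ A x; exact: neg_entropy_translate.
Qed.

End EntropyIncrements.

(** * Continuity points of a specification *)

Section ContinuityPoints.
Context {R : realType} {d : nat} {E : finType} {p : E}.
Local Notation Zd := 'rV[int]_d.
Local Notation Omega := (config d p).
Implicit Types (L D : {fset Zd}) (u v w : Omega).

Lemma continuous_agreeP (F : Omega -> R) w : {for w, continuous F} <->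
  forall e, 0 < e ->
    exists L, forall v, agree [set` L] v w -> `|F w - F v| < e.
Proof.
have FF : Filter (nbhs w) by exact: nbhs_filter.
have -> : {for w, continuous F} = (F @ nbhs w --> F w) by [].
split=> [/cvgrPdist_lt Fw e e0|Fw].
  by have /nbhs_agreeP := Fw e e0.
by apply/cvgrPdist_lt => e /Fw h; apply/nbhs_agreeP.
Qed.

(** The continuity points of any function form a countable intersection of open
    sets, namely those where the oscillation is below 1, 1/2, 1/3, etc. *)
Lemma measurable_continuity_points (F : Omega -> R) :
  measurable [set w | {for w, continuous F}].
Proof.
pose U k := [set w | exists L, forall u v, agree [set` L] u w ->
  agree [set` L] v w -> `|F u - F v| < k.+1%:R^-1].
suff -> : [set w | {for w, continuous F}] = \bigcap_k U k.
  apply: bigcapT_measurable => k; apply: open_measurable_config.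
  apply: (open_agreeP _).2.
  move=> w [L LU]; exists L => v vw; exists L => u u' uv u'v.
  by apply: LU => x xL; rewrite ?uv ?u'v // vw.
apply/seteqP; split=> w /= Fw.
  move=> k _; have k0 : 0 < k.+1%:R^-1 / 2 :> R by rewrite divr_gt0 ?invr_gt0.
  have [L LF] := (continuous_agreeP F w).1 Fw _ k0.
  exists L => u v /LF uw /LF vw.
  have -> : F u - F v = (F w - F v) - (F w - F u) by lra.
  by rewrite (le_lt_trans (ler_normB _ _)) // [ltRHS]splitr ltrD.
apply/continuous_agreeP => e e0.
have [k ke] : exists k, k.+1%:R^-1 < e.
  exists (Num.truncn e^-1).+1.
  rewrite invf_plt ?posrE //; apply: lt_trans (truncnS_gt _) _.
  by rewrite ltr_nat.
have [L LF] := Fw k I; exists L => v vw.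
by apply: lt_trans ke; exact: LF.
Qed.

Variable g : specification R d p.

Lemma spec_setT L w : g L w setT = 1%E.
Proof. exact: prob_kernel. Qed.

Lemma spec_lty L w : (g L w setT < +oo)%E.
Proof. by rewrite spec_setT ltry. Qed.

Definition spec_prob L (A : set Omega) w : R := fine (g L w A).

Lemma spec_probE L A w : measurable A -> (spec_prob L A w)%:E = g L w A.
Proof.
move=> mA; rewrite fineK // ge0_fin_numE //.
by apply: le_lt_trans (spec_lty L w); apply: le_measure; rewrite ?inE.
Qed.

Lemma spec_prob_ge0 L A w : 0 <= spec_prob L A w.
Proof. exact: fine_ge0. Qed.

Lemma spec_prob_le1 L A w : measurable A -> spec_prob L A w <= 1.
Proof.
move=> mA; rewrite -lee_fin spec_probE // -(spec_setT L w).
by apply: le_measure; rewrite ?inE.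
Qed.

Lemma coord_measurable_spec L A : measurable A ->
  @measurable_fun _ _ (coord_space p (~` [set` L])) _ setT (fun w => g L w A).
Proof. exact: measurable_kernel. Qed.

Lemma measurable_spec_prob L A : measurable A ->
  measurable_fun setT (spec_prob L A).
Proof.
move=> mA; apply: measurableT_comp => //.
exact: coord_measurable_fun_sub (coord_measurable_spec (L := L) mA).
Qed.

Lemma spec_prob_depends_on L A : measurable A ->
  depends_on (~` [set` L]) (spec_prob L A).
Proof.
move=> mA; apply: (depends_on_comp (@fine R)).
exact: coord_measurable_fun_depends_on (coord_measurable_spec (L := L) mA).
Qed.

Lemma spec_cylinder_gt0 L : L != fset0 ->
  exists2 a : R, 0 < a &
    forall v (s : {ffun L -> E}), a <= spec_prob L (cylinder s) v.
Proof.
move=> /(spec_nonnull g)[a [b [a0 _ _ aP _]]]; exists a => // v s.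
rewrite -lee_fin spec_probE; last exact: measurable_cylinder.
apply/ltW/(lt_le_trans aP)/ereal_inf_lbound.
by exists (extend s) => //; exists v => //; rewrite restr_extend.
Qed.

Lemma cylinder_local_fun D (s : {ffun D -> E}) :
  local_fun (\1_(cylinder (p := p) s) : Omega -> R).
Proof.
exists D; apply: (@measurable_indic _ (coord_space p [set` D])).
have -> : cylinder (p := p) s = [set v | agree [set` D] v (extend s)].
  apply/seteqP; split=> v /=.
    by move=> vs; apply/restrP; rewrite restr_extend.
  by move=> /restrP; rewrite restr_extend.
exact: agree_coord_event.
Qed.

Lemma local_fun_depends_on (f : Omega -> R) : local_fun f ->
  exists D, depends_on [set` D] f.
Proof.
move=> [D mf]; exists D => v w vw; apply/EFin_inj.
apply: (@coord_measurable_fun_depends_on _ _ _ _ [set` D] (EFin \o f)) => //.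
exact/(@measurable_EFinP _ (coord_space p [set` D])).
Qed.

(** A local function is a linear combination of indicators of cylinders, so
    countably many functions decide continuity. *)
Lemma continuity_setP w : continuity_set g w <->
  forall L D (s : {ffun D -> E}),
    {for w, continuous (spec_prob L (cylinder s))}.
Proof.
split=> [cw L D s|cw L f /local_fun_depends_on[D Df]].
  have := cw L _ (cylinder_local_fun s).
  rewrite (_ : (fun v => _) = spec_prob L (cylinder s)) //.
  apply/funext => v; rewrite /Rintegral integral_indic ?setIT //.
  exact: measurable_cylinder.
have -> : (fun v => \int[g L v]_u f u) =
    (fun v => \sum_(s : {ffun D -> E})
                spec_prob L (cylinder s) v * f (extend s)).
  apply/funext => v.
  rewrite -(Rintegral_finite_valued (fun s => f (extend s)) (spec_lty L v)
    (depends_on_restr (L := D))).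
  apply: eq_Rintegral => u _; apply: Df; apply/restrP.
  by rewrite restr_extend.
have FF : Filter (nbhs w) by exact: nbhs_filter.
have sum_cvg := @cvg_big _ _ +%R 0 xpredT (@add_continuous R^o) _ (nbhs w)
  (index_enum _) (fun (s : {ffun D -> E}) v =>
    spec_prob L (cylinder s) v * f (extend s)) (fun s =>
    spec_prob L (cylinder s) w * f (extend s)) FF.
apply: sum_cvg => s _.
by apply: cvgMr_tmp; exact: cw.
Qed.

(** That mu gives mass 1 to this set says something about mu-almost every
    configuration only once the set is known to be an event. *)
Lemma measurable_past_continuity_set :
  measurable (past_continuity_set g : set Omega).
Proof.
pose J : countType := ({fset Zd} * {D : {fset Zd} & {ffun D -> E}})%type.
pose C (i : J) := [set w | {for w, continuous
  (spec_prob i.1 (cylinder (tagged i.2)))}].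
have -> : past_continuity_set g =
    @plus_future d E p @^-1` (\bigcap_(i in [set: J]) C i).
  apply/seteqP; split=> w /=.
    by move=> /continuity_setP cw [L [D s]] _; exact: cw.
  by move=> cw; apply/continuity_setP => L D s; exact: (cw (L, Tagged _ s) I).
rewrite -[X in measurable X]setTI; apply: measurable_plus_future => //.
rewrite -[X in measurable X]setCK setC_bigcap; apply: measurableC.
apply: countable_bigcupT_measurable => [|i].
  exact: countableP.
by apply: measurableC; exact: measurable_continuity_points.
Qed.

Lemma past_continuity_ae (mu : probability Omega R) :
  mu (past_continuity_set g) = 1%E ->
  {ae mu, forall w, continuity_set g (plus_future w)}.
Proof.
move=> muP; have mP := measurable_past_continuity_set.
exists (~` past_continuity_set g); split=> //; first exact: measurableC.
by rewrite probability_setC // muP subee.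
Qed.

End ContinuityPoints.

(** * Gibbs measures against the configuration +1 *)

Section BoundedConvergence.
Context d (T : measurableType d) (R : realType) (m : probability T R).

Lemma bounded_convergence (f_ : nat -> T -> R) (f : T -> R) (K : R) :
  (forall n, measurable_fun setT (f_ n)) -> measurable_fun setT f ->
  (forall n x, `|f_ n x| <= K) ->
  {ae m, forall x, f_ n x @[n --> \oo] --> f x} ->
  (\int[m]_x f_ n x) @[n --> \oo] --> \int[m]_x f x.
Proof.
move=> mf_ mf fK f_f.
have mfn n : measurable_fun setT (EFin \o f_ n) by exact/measurable_EFinP.
have mEf : measurable_fun setT (EFin \o f) by exact/measurable_EFinP.
have ae_cvg : {ae m, forall x, setT x ->
    (EFin \o f_ n) x @[n --> \oo] --> (EFin \o f) x}.
  apply: filterS f_f => x fx _; apply: cvg_EFin => //.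
  by apply: nearW.
have iK : m.-integrable setT (EFin \o cst K).
  exact: finite_measure_integrable_cst.
have ae_bnd : {ae m, forall x n, setT x ->
    (`|(EFin \o f_ n) x| <= (EFin \o cst K) x)%E}.
  by apply: aeW => x n _ /=; rewrite lee_fin.
have [intf _ cvgf] :=
  dominated_convergence measurableT mfn mEf ae_cvg iK ae_bnd.
have fin : (\int[m]_x (EFin \o f) x \is a fin_num)%E.
  exact: integrable_fin_num.
by apply: fine_cvg; rewrite /Rintegral fineK.
Qed.

End BoundedConvergence.

Section GibbsIncrements.
Context {R : realType} {d : nat} {E : finType} {p : E}.
Local Notation Zd := 'rV[int]_d.
Local Notation Omega := (config d p).
Implicit Types (L D : {fset Zd}) (u v w : Omega).
Variable g : specification R d p.

(** Integrating the kernel over an event B of the outside of L gives nu of the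
    intersection, so bounds on the kernel over B pass to nu. *)
Lemma gibbs_sandwich (nu : probability Omega R) L (A B : set Omega)
    (lo hi : R) :
  gibbs g nu -> measurable A -> <<s coord_events (~` [set` L]) >> B ->
  (forall v, B v -> lo <= spec_prob g L A v <= hi) ->
  lo * fine (nu B) <= fine (nu (A `&` B)) <= hi * fine (nu B).
Proof.
move=> nuG mA BL AB; have mB := coord_sigma_sub BL.
have nuE : (\int[nu]_(v in B) (spec_prob g L A v)%:E)%E = nu (A `&` B).
  have [_ /(_ B BL) <-] := nuG L A mA.
  by apply: eq_integral => v _; rewrite spec_probE.
have mspec : measurable_fun B (fun v => (spec_prob g L A v)%:E : \bar R).
  apply/measurable_EFinP; apply: measurable_funTS.
  exact: measurable_spec_prob.
have nuB : (fine (nu B))%:E = nu B by rewrite fineK // fin_num_measure.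
have nuAB : (fine (nu (A `&` B)))%:E = nu (A `&` B).
  by rewrite fineK // fin_num_measure //; exact: measurableI.
apply/andP; split.
  have [lo0|/ltW lo0] := leP 0 lo; last first.
    by rewrite (le_trans (mulr_le0_ge0 lo0 _)) ?fine_ge0.
  rewrite -lee_fin EFinM nuB nuAB -nuE -(integral_cst _ mB).
  apply: ge0_le_integral => // v Bv; rewrite lee_fin //.
  by have /andP[] := AB v Bv.
rewrite -lee_fin EFinM nuB nuAB -nuE -(integral_cst _ mB).
apply: ge0_le_integral => // v Bv; rewrite lee_fin ?spec_prob_ge0 //.
by have /andP[] := AB v Bv.
Qed.

(** Non-nullness bounds the kernel of L from below on each pattern, whatever the
    boundary condition. *)
Lemma gibbs_window_prob_gt0 (nu : probability Omega R) L w :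
  gibbs g nu -> 0 < window_prob nu L w.
Proof.
move=> nuG; have [->|L0] := eqVneq L fset0; first by rewrite window_prob0.
have [a a0 aP] := spec_cylinder_gt0 g L0.
have mcyl := @measurable_cylinder d E p L (restr L w).
have := @gibbs_sandwich nu L _ setT a 1 nuG mcyl _ _.
rewrite setIT [X in fine X](@probability_setT _ _ _ nu) !mulr1.
case/(_ _ _)/andP => [|v _|h _]; last exact: lt_le_trans h.
  exact: (@measurableT _ (coord_space p _)).
by rewrite aP spec_prob_le1.
Qed.

Definition spin_event (e : E) : set Omega := [set v | v 0 = e].

Lemma measurable_spin_event e : measurable (spin_event e).
Proof.
apply: (@depends_on_measurable _ _ _ [fset 0]%fset) => v w vw.
by rewrite /spin_event /= vw //= inE.
Qed.

Definition spin_prob e w : R := spec_prob g [fset 0]%fset (spin_event e) w.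

Lemma spin_eventE e : spin_event e =
  cylinder (p := p) ([ffun=> e] : {ffun [fset (0 : Zd)]%fset -> E}).
Proof.
apply/seteqP; split=> v /=.
  move=> ve; apply/ffunP => x; rewrite !ffunE.
  by have := valP x; rewrite /= inE => /eqP ->.
have i0 : (0 : Zd) \in [fset (0 : Zd)]%fset by rewrite inE.
by move=> /ffunP/(_ [` i0]%fset); rewrite !ffunE.
Qed.

Lemma spin_prob_lower : exists2 a : R, 0 < a & forall e w, a <= spin_prob e w.
Proof.
have [|a a0 aP] := @spec_cylinder_gt0 _ _ _ _ g [fset 0]%fset.
  by apply/fset0Pn; exists 0; rewrite inE.
by exists a => // e w; rewrite /spin_prob spin_eventE.
Qed.

Lemma spin_prob_le1 e w : spin_prob e w <= 1.
Proof. by apply: spec_prob_le1; exact: measurable_spin_event. Qed.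

Lemma spin_prob_continuous e w : continuity_set g w ->
  {for w, continuous (spin_prob e)}.
Proof.
by move=> /continuity_setP cw; rewrite /spin_prob spin_eventE; exact: cw.
Qed.

Lemma measurable_spin_prob e : measurable_fun setT (spin_prob e).
Proof. by apply: measurable_spec_prob; exact: measurable_spin_event. Qed.

Definition plus_at_origin w : Omega := fun x => if x == 0 then p else w x.

Definition surrounding L w : set Omega :=
  [set v | agree [set` (L `\ 0)%fset] v w].

Lemma surrounding_plus_at_origin L w :
  surrounding L (plus_at_origin w) = surrounding L w.
Proof.
apply/seteqP; split=> v vw x xL; rewrite vw // /plus_at_origin;
  by move: xL; rewrite /= !inE => /andP[/negPf->].
Qed.

Lemma window_prob_surrounding (nu : probability Omega R) L w : 0 \in L ->
  window_prob nu L w = fine (nu (spin_event (w 0) `&` surrounding L w)).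
Proof.
move=> L0; rewrite /window_prob /pattern_prob; congr (fine (nu _)).
apply/seteqP; split=> v /=.
  move=> /restrP vw; split; first exact: vw.
  by move=> x /=; rewrite !inE => /andP[_ xL]; exact: vw.
case=> v0 vw; apply/restrP => x xL; have [->//|x0] := eqVneq x 0.
by apply: vw; rewrite /= !inE x0.
Qed.

Lemma window_prob_plus_at_origin (nu : probability Omega R) L w : 0 \in L ->
  window_prob nu L (plus_at_origin w) =
  fine (nu (spin_event p `&` surrounding L w)).
Proof.
move=> L0; rewrite window_prob_surrounding // surrounding_plus_at_origin.
by rewrite /plus_at_origin eqxx.
Qed.

Lemma spin_sandwich (nu : probability Omega R) L w e (lo hi : R) :
  gibbs g nu ->
  (forall v, surrounding L w v -> lo <= spin_prob e v <= hi) ->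
  lo * fine (nu (surrounding L w)) <=
    fine (nu (spin_event e `&` surrounding L w)) <=
    hi * fine (nu (surrounding L w)).
Proof.
move=> nuG loP.
apply: gibbs_sandwich nuG _ _ loP; first exact: measurable_spin_event.
apply: agree_coord_event => x /=; rewrite !inE => /andP[x0 _].
exact/negP.
Qed.

Lemma surrounding_gt0 (nu : probability Omega R) L w : gibbs g nu ->
  0 < fine (nu (surrounding L w)).
Proof.
move=> nuG; have := gibbs_window_prob_gt0 (L `\ 0)%fset w nuG.
by rewrite -lte_fin window_probE -(@fineK _ (nu _)) ?fin_num_measure //;
  exact: measurable_agree.
Qed.

Definition log_ratio (nu : probability Omega R) L w : R :=
  ln (window_prob nu L w) - ln (window_prob nu L (plus_at_origin w)).

Definition spin_log_ratio w : R := ln (spin_prob (w 0) w) - ln (spin_prob p w).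

Lemma log_ratioE (nu : probability Omega R) L w : gibbs g nu -> 0 \in L ->
  log_ratio nu L w =
    ln (fine (nu (spin_event (w 0) `&` surrounding L w)) /
        fine (nu (surrounding L w))) -
    ln (fine (nu (spin_event p `&` surrounding L w)) /
        fine (nu (surrounding L w))).
Proof.
move=> nuG L0; have S0 := surrounding_gt0 L w nuG.
have := gibbs_window_prob_gt0 L w nuG.
have := gibbs_window_prob_gt0 L (plus_at_origin w) nuG.
rewrite /log_ratio window_prob_plus_at_origin // window_prob_surrounding //.
move=> p0 w0.
by rewrite !ln_div ?posrE //; lra.
Qed.

Lemma log_ratio_bounded : exists K : R, forall (nu : probability Omega R) L w,
  gibbs g nu -> 0 \in L -> `|log_ratio nu L w| <= K.
Proof.
have [a a0 aP] := spin_prob_lower; exists (- ln a) => nu L w nuG L0.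
have S0 := surrounding_gt0 L w nuG.
have bnd e : ln a <= ln (fine (nu (spin_event e `&` surrounding L w)) /
                         fine (nu (surrounding L w))) <= 0.
  have /andP[lo hi] : a * fine (nu (surrounding L w)) <=
      fine (nu (spin_event e `&` surrounding L w)) <=
      1 * fine (nu (surrounding L w)).
    by apply: spin_sandwich => // v _; rewrite aP spin_prob_le1.
  have lo' : a <= fine (nu (spin_event e `&` surrounding L w)) /
                  fine (nu (surrounding L w)) by rewrite ler_pdivlMr.
  rewrite ler_ln ?posrE // ?(lt_le_trans a0) // lo' /=.
  by apply: ln_le0; rewrite ler_pdivrMr.
rewrite log_ratioE // ler_norml.
by have := bnd (w 0); have := bnd p; lra.
Qed.

(** Given its surroundings in L, the conditional probability of a spin at 0
    is an average of the kernel over configurations close to w, hence tends to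
    the kernel at w when w is a continuity point. *)
Lemma spin_ratio_cvg (nu : probability Omega R) (L : nat -> {fset Zd}) w e :
  gibbs g nu -> continuity_set g w ->
  (forall n, (box d n `<=` L n)%fset) ->
  (fine (nu (spin_event e `&` surrounding (L n) w)) /
     fine (nu (surrounding (L n) w))) @[n --> \oo] --> spin_prob e w.
Proof.
move=> nuG cw boxL; apply/cvgrPdist_le => eps eps0.
have [D DP] :=
  (continuous_agreeP _ _).1 (spin_prob_continuous (e := e) cw) eps eps0.
have [m Dm] := sub_box D; near=> n.
have mn : (m <= n)%N by near: n; exact: nbhs_infty_ge.
have close v : surrounding (L n) w v ->
    spin_prob e w - eps <= spin_prob e v <= spin_prob e w + eps.
  (* The kernel at 0 ignores the spin at 0, which may be set to that of w. *)
  move=> vw; pose v' : Omega := fun x => if x == 0 then w 0 else v x.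
  have <- : spin_prob e v' = spin_prob e v.
    apply: (@spec_prob_depends_on _ _ _ _ g [fset 0]%fset).
      exact: measurable_spin_event.
    by move=> x /= /negP; rewrite inE /v' => /negPf ->.
  have v'w : agree [set` D] v' w.
    move=> x xD; rewrite /v'; case: eqVneq => [->//|x0]; apply: vw.
    rewrite /= !inE x0; apply: (fsubsetP (boxL n)).
    by apply: (fsubsetP (box_mono mn)); exact: (fsubsetP Dm).
  by have := ltW (DP v' v'w); rewrite distrC ler_distl.
have S0 := surrounding_gt0 (L n) w nuG.
rewrite distrC ler_distl ler_pdivlMr // ler_pdivrMr //.
exact: spin_sandwich.
Unshelve. all: by end_near. Qed.

Lemma log_ratio_cvg (nu : probability Omega R) (L : nat -> {fset Zd}) w :
  gibbs g nu -> continuity_set g w ->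
  (forall n, (box d n `<=` L n)%fset) ->
  log_ratio nu (L n) w @[n --> \oo] --> spin_log_ratio w.
Proof.
move=> nuG cw boxL; have [a a0 aP] := spin_prob_lower.
have L0 n : 0 \in L n by apply: (fsubsetP (boxL n)); exact: mem0_box.
rewrite (_ : (fun n => _) = (fun n =>
    ln (fine (nu (spin_event (w 0) `&` surrounding (L n) w)) /
        fine (nu (surrounding (L n) w))) -
    ln (fine (nu (spin_event p `&` surrounding (L n) w)) /
        fine (nu (surrounding (L n) w))))); last first.
  by apply/funext => n; exact: log_ratioE.
have lncvg e := cvg_comp _ _ (spin_ratio_cvg (e := e) nuG cw boxL)
  (continuous_ln (lt_le_trans a0 (aP e w))).
exact: cvgB (lncvg _) (lncvg _).
Qed.

Lemma measurable_spin_log_ratio : measurable_fun setT spin_log_ratio.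
Proof.
have mln e : measurable_fun setT (fun w => ln (spin_prob e w)).
  apply: measurableT_comp; first exact: measurable_ln.
  exact: measurable_spin_prob.
apply: measurable_funB => //.
rewrite (_ : (fun w => _) =
    (fun w => \sum_(e : E) (\1_(spin_event e) w) * ln (spin_prob e w))).
  apply: measurable_sum => e; apply: measurable_funM => //.
  by apply: measurable_indic; exact: measurable_spin_event.
apply/funext => w; rewrite (bigD1 (w 0)) //= big1 ?addr0.
  by rewrite indicE mem_set // mul1r.
move=> e ew; rewrite indicE memNset ?mul0r //= => /esym/eqP.
by rewrite (negPf ew).
Qed.

Lemma log_ratio_depends_on (nu : probability Omega R) L :
  depends_on [set` L] (log_ratio nu L).
Proof.
move=> v w vw; rewrite /log_ratio; congr (ln _ - ln _);
  apply: window_prob_depends_on => // x xL.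
by rewrite /plus_at_origin; case: ifP => // _; exact: vw.
Qed.

Variable mu : probability Omega R.

Lemma cross_log_increment (nu : probability Omega R) L : 0 \in L ->
  increment (cross_log mu nu) L = \int[mu]_w log_ratio nu L (plus_future w).
Proof.
move=> L0; rewrite /increment /cross_log.
have int A : mu.-integrable setT
    (EFin \o (fun w => ln (window_prob nu L (plus_outside A w)))).
  apply: (integrable_local (L := A) (probability_lty mu)).
  exact: (@depends_on_plus_outside _ _ _ _ A
    (fun w => ln (window_prob nu L w))).
rewrite -RintegralB //; apply: eq_Rintegral => w _.
rewrite /log_ratio.
congr (ln _ - ln _); apply: window_prob_depends_on => x /= xL.
  by rewrite /plus_outside /plus_future !inE xL.
by rewrite /plus_outside /plus_at_origin /plus_future !inE xL /=; case: eqVneq.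
Qed.

(** The limit involves the specification but not nu itself. Dominated
    convergence being sequential, uniformity over all windows that contain a box
    comes by contradiction from a sequence of bad windows. *)
Lemma cross_log_increment_cvg (nu : probability Omega R) (e : R) :
  gibbs g nu -> mu (past_continuity_set g) = 1%E -> 0 < e ->
  exists m, forall L, (box d m `<=` L)%fset ->
    `|increment (cross_log mu nu) L -
      \int[mu]_w spin_log_ratio (plus_future w)| <= e.
Proof.
move=> nuG C1 e0; have [K KP] := log_ratio_bounded.
apply: contrapT => /forallNP bad.
have {bad} /choice[L LP] : forall m, exists L : {fset Zd},
    (box d m `<=` L)%fset /\ e < `|increment (cross_log mu nu) L -
      \int[mu]_w spin_log_ratio (plus_future w)|.
  move=> m; apply: contrapT => /forallNP good; apply: (bad m) => L mL.
  by rewrite leNgt; apply/negP => eL; apply: (good L).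
have boxL n := (LP n).1.
have L0 n : 0 \in L n by apply: (fsubsetP (boxL n)); exact: mem0_box.
have mpf := @measurable_plus_future d E p.
have := @bounded_convergence _ _ _ mu
  (fun n w => log_ratio nu (L n) (plus_future w))
  (fun w => spin_log_ratio (plus_future w)) K.
case/(_ _ _ _ _)/cvgrPdist_lt/(_ e e0).
- move=> n; apply: measurableT_comp => //.
  apply: (@measurable_depends_on _ _ _ _ _ (L n)).
  exact: log_ratio_depends_on.
- by apply: measurableT_comp => //; exact: measurable_spin_log_ratio.
- by move=> n w; exact: KP.
- apply: filterS (past_continuity_ae C1) => w cw; exact: log_ratio_cvg.
move=> n _ /(_ n (leqnn n)); have [_] := LP n.
by rewrite cross_log_increment // distrC => /lt_trans/[apply]; rewrite ltxx.
Qed.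

Lemma cross_log_density (nu : probability Omega R) :
  gibbs g nu -> translation_invariant mu -> translation_invariant nu ->
  mu (past_continuity_set g) = 1%E ->
  (#|` box d n|%:R^-1 * (cross_log mu nu (box d n) (box d n) -
     ln (plus_prob nu (box d n)))) @[n --> \oo] -->
  \int[mu]_w spin_log_ratio (plus_future w).
Proof.
move=> nuG muinv nuinv C1; have [K KP] := log_ratio_bounded.
have bnd L : 0 \in L -> `|increment (cross_log mu nu) L| <= K.
  move=> L0; rewrite cross_log_increment //.
  have mlr : measurable_fun setT (fun w => log_ratio nu L (plus_future w)).
    apply: measurableT_comp; last exact: measurable_plus_future.
    apply: (@measurable_depends_on _ _ _ _ _ L).
    exact: log_ratio_depends_on.
  have intK : mu.-integrable setT (EFin \o cst K).
    exact: finite_measure_integrable_cst.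
  have intf : mu.-integrable setT
      (EFin \o (fun w => log_ratio nu L (plus_future w))).
    apply: (bounded_integrable (probability_lty mu) mlr (K := K)) => w.
    exact: KP.
  apply: le_trans (le_normr_Rintegral measurableT intf) _.
  apply: le_trans (le_Rintegral measurableT _ intK _) _.
  - exact: integrable_norm intf.
  - by move=> w _; exact: KP.
  by rewrite Rintegral_cst // [X in fine X]probability_setT mulr1.
have := spatial_average bnd (fun e => cross_log_increment_cvg nuG C1).
apply: cvg_trans; apply: near_eq_cvg; apply: nearW => n.
rewrite sum_increments_translate ?cross_log0 //.
by move=> L A x; exact: cross_log_translate.
Qed.

End GibbsIncrements.

(** * The relative entropy density *)

Unset Implicit Arguments.

Theorem theorem4 (R : realType) (d : nat) (E : finType) (p : E)
  (g : specification R d p) (mu nu : probability (config d p) R)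
  (d_gt0 : (0 < d)%N)
  (g_inv : spec_translation_invariant g)
  (mu_inv : translation_invariant mu)
  (nu_gibbs : gibbs_inv g nu)
  (C1 : mu (past_continuity_set g) = 1%E)
  (C2 : gibbs_inv g mu ->
    (#|` box d n|%:R^-1 * ln (plus_prob mu (box d n) / plus_prob nu (box d n)))
      @[n --> \oo] --> (0 : R))
  (nu_rate : plus_rate_exists nu) :
  (exists h : R, is_rel_entropy_density mu nu h%:E) /\
  (gibbs_inv g mu -> is_rel_entropy_density mu nu 0%:E).
Proof.
case: nu_gibbs => nuG nu_inv.
have crossC := cross_log_density nuG mu_inv nu_inv C1.
set c := Rintegral _ _ _ in crossC.
have densityE (h : R) :
    (#|` box d n|%:R^-1 * (neg_entropy mu (box d n) -
        cross_log mu nu (box d n) (box d n))) @[n --> \oo] --> h ->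
    is_rel_entropy_density mu nu h%:E.
  move=> cvgh; rewrite /is_rel_entropy_density.
  under eq_fun do
    rewrite (rel_entropyE mu (fun w => gibbs_window_prob_gt0 _ w nuG)) -EFinM.
  by apply: cvg_EFin => //; apply: nearW.
split.
  have [s sC] := neg_entropy_density mu_inv.
  exists (s - c + lim (plus_rate nu @ \oo)); apply: densityE.
  have rateC : plus_rate nu @ \oo --> lim (plus_rate nu @ \oo) by [].
  apply: cvg_trans (cvgD (cvgB sC crossC) rateC).
  apply: near_eq_cvg; apply: nearW => n.
  by rewrite !fctE /plus_rate; ring.
case=> muG _; apply: densityE.
have crossmuC := cross_log_density muG mu_inv mu_inv C1.
rewrite -(addr0 0) -[X in X + 0](subrr c).
apply: cvg_trans (cvgD (cvgB crossmuC crossC) (C2 (conj muG mu_inv))).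
apply: near_eq_cvg; apply: nearW => n.
rewrite !fctE cross_log_diag ln_div ?posrE; last 2 first.
- exact: gibbs_window_prob_gt0 muG.
- exact: gibbs_window_prob_gt0 nuG.
by ring.
Qed.
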